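(* Let $a<b$. For any $r\in(0,b-a)$ and $c>2-\frac{r}{b-a}$, the family $H_1^{\updownarrow}(a,b)$ is an \[\left(r,\ cr,\ 1-\left(2-\frac{r}{b-a}\right)\cdot\frac{r}{2(b-a)},\ 1-c\cdot\frac{r}{2(b-a)}\right)\text{-LSH family}\] for the $D_1^{\updownarrow}$ distance on step functions $[0,1]\to[a,b]$.
   Context: A family $H$ of functions $h:Z\to\Gamma$ (sampled uniformly) is an $(r,cr,p_1,p_2)$-LSH family for a distance $d$ (with $r>0$, $c>1$, $p_1>p_2$) if for all $x,y\in Z$: $d(x,y)\le r$ implies $\Pr_h[h(x)=h(y)]\ge p_1$, and $d(x,y)\ge cr$ implies $\Pr_h[h(x)=h(y)]\le p_2$. For $A<B$, $H_1(A,B)=\{h_{(x,y)}:(x,y)\in[0,1]\times[A,B]\}$ with $(x,y)$ uniform in $[0,1]\times[A,B]$, where for $f:[0,1]\to[A,B]$, $h_{(x,y)}(f)$ is $1$ if $f(x)>y$, $-1$ if $f(x)<y$, and $0$ if $f(x)=y$. For $\phi:[0,1]\to\mathbb{R}$, $\bar\phi=\int_0^1\phi$ and $\hat\phi=\phi-\bar\phi$. The family $H_1^{\updownarrow}(a,b)$ consists of the maps $f\mapsto h(\hat f)$ for $h\in H_1(a-b,b-a)$ (sampled uniformly). $D_1^{\updownarrow}(f,g)=\min_{\alpha\in\mathbb{R}}\int_0^1|f(x)+\alpha-g(x)|\,dx$. A step function is piecewise constant on finitely many intervals. *)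

(* Defs.v *)
From HB Require Import structures.
From mathcomp Require Import all_boot all_order all_algebra.
From mathcomp Require Import all_classical all_reals all_analysis.
Set Implicit Arguments.
Unset Strict Implicit.
Unset Printing Implicit Defensive.
Import Order.TTheory GRing.Theory Num.Theory.
Import numFieldNormedType.Exports.
Local Open Scope classical_set_scope.
Local Open Scope ring_scope.

(* A family of functions Z -> G, indexed by a subset of a measurable space. *)
Record hash_family (d : measure_display) (I : measurableType d) (Z G : Type) :=
  HashFamily { index_set : set I; hash : I -> Z -> G }.

(* The event h(x) = h(y), as a subset of the index set. *)
Definition collision (d : measure_display) (I : measurableType d) (Z G : Type)
    (H : hash_family I Z G) (x y : Z) : set I :=
  [set w | index_set H w /\ hash H w x = hash H w y].

(* Only meaningful when 0 < mu S < +oo and E is a measurable subset of S. *)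
Definition uniform_pr (d : measure_display) (I : measurableType d)
    (R : realType) (mu : set I -> \bar R) (S E : set I) : R :=
  fine (mu E) / fine (mu S).

(* Functions are sampled from H uniformly with respect to mu.  The
   measurability clause says that the probabilities below make sense. *)
Definition LSH_family (d : measure_display) (I : measurableType d)
    (R : realType) (Z G : Type) (mu : set I -> \bar R)
    (H : hash_family I Z G) (domain : set Z) (dist : Z -> Z -> R)
    (r c p1 p2 : R) : Prop :=
  [/\ 0 < r, 1 < c, p2 < p1 &
   forall x y : Z, domain x -> domain y ->
   [/\ measurable (collision H x y),
       dist x y <= r ->
         p1 <= uniform_pr mu (index_set H) (collision H x y) &
       c * r <= dist x y ->
         uniform_pr mu (index_set H) (collision H x y) <= p2]].

(* Functions on [0,1] are represented by functions R -> R; every notion below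
   depends only on their values on [0,1]. *)

Definition hash1 (R : realType) (w : R * R) (f : R -> R) : int :=
  if w.2 < f w.1 then 1 else if f w.1 < w.2 then -1 else 0.

Definition H1 (R : realType) (A B : R) :
    hash_family (measurableTypeR R * measurableTypeR R)%type (R -> R) int :=
  @HashFamily _ (measurableTypeR R * measurableTypeR R)%type _ _
    (`[0, 1]%classic `*` `[A, B]%classic) (@hash1 R).

Definition mean (R : realType) (f : R -> R) : R :=
  \int[@lebesgue_measure R]_(x in `[0, 1]) f x.

Definition centered (R : realType) (f : R -> R) : R -> R :=
  fun x => f x - mean f.

Definition H1_updown (R : realType) (a b : R) :
    hash_family (measurableTypeR R * measurableTypeR R)%type (R -> R) int :=
  @HashFamily _ (measurableTypeR R * measurableTypeR R)%type _ _
    (index_set (H1 (a - b) (b - a)))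
    (fun w f => hash (H1 (a - b) (b - a)) w (centered f)).

Definition area (R : realType) :
    set (measurableTypeR R * measurableTypeR R) -> \bar R :=
  (@lebesgue_measure R \x @lebesgue_measure R)%E.

(* The least element of S (0 if there is none). *)
Definition minimum (R : realType) (S : set R) : R := xget 0 (S `&` lbound S).

Definition D1_updown (R : realType) (f g : R -> R) : R :=
  minimum (range (fun alpha : R =>
    \int[@lebesgue_measure R]_(x in `[0, 1]) `|f x + alpha - g x|)).

(* Intervals may have any kind of endpoints and may be single points. *)
Definition step_function (R : realType) (f : R -> R) : Prop :=
  exists (n : nat) (J : 'I_n -> interval R),
    [/\ \bigcup_(i in setT) [set` J i] = `[0, 1]%classic,
        trivIset setT (fun i => [set` J i]) &
        forall i, exists v, forall x, x \in J i -> f x = v].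

Definition step_functions (R : realType) (a b : R) : set (R -> R) :=
  [set f | step_function f /\ forall x : R, 0 <= x <= 1 -> a <= f x <= b].

(* Main.v *)
Require Import Defs.
From HB Require Import structures.
From mathcomp Require Import all_boot all_order all_algebra.
From mathcomp Require Import all_classical all_reals all_analysis.
From mathcomp Require Import ring lra.
Import Order.TTheory GRing.Theory Num.Theory.
Import numFieldNormedType.Exports.
Local Open Scope classical_set_scope.
Local Open Scope ring_scope.

(* Write M = b - a and phi = f - g, so that |phi| <= M on [0,1].  The hashes of
   the centered f and g differ at (x, y) exactly when their values at x are
   distinct and y lies in the closed interval between them.  Hence the collision
   probability is 1 - L / (2 M), where L is the integral of |phi - mean phi|.
   Clearly D <= L, where D is the D1_updown distance, which gives p2.

   For p1 one needs M L <= D (2 M - D).  Let D be attained at m, and put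
   u = phi - m, d = the integral of u, h = M - m and l = M + m; replacing phi by
   - phi one may assume 0 <= d.  Minimality of D against the shifts M and - M
   gives D + d <= h and D - d <= l.  The convex function t |-> max (t - d) 0
   lies below its chord on [0, h], and integrating this at t = u gives
   h L <= (D + d) (h - d).  The rest is algebra, as h + l = 2 M. *)

(** * Two inequalities over ordered fields *)

Lemma weighted_deviation_bound (R : realFieldType) (h l d D L : R) :
  0 <= d -> d <= D -> D + d <= h -> D - d <= l -> 0 < h ->
  h * L <= (D + d) * (h - d) ->
  (h + l) * L <= 2 * D * (h + l - D).
Proof.
move=> d0 dD hh hl h0 HL.
rewrite -(ler_pM2l h0).
have W0 : 0 <= h + l by lra.
apply: (@le_trans _ _ ((h + l) * ((D + d) * (h - d)))).
  by rewrite mulrCA; apply: ler_wpM2l.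
(* The difference of the two sides is a nonnegative combination of e1, e2, e3. *)
have e1 : 0 <= (D - d) * (h + l) * (h - (D + d)).
  by rewrite !mulr_ge0 //; lra.
have e2 : 0 <= (l - (D - d)) * (h * (D - d) + (D + d) ^+ 2).
  apply: mulr_ge0; first lra.
  by apply: addr_ge0; [apply: mulr_ge0; lra|exact: sqr_ge0].
have e3 : 0 <= (D - d) * (h - (D + d)) ^+ 2.
  by apply: mulr_ge0; [lra|exact: sqr_ge0].
nra.
Qed.

(* As |t| + t = 2 max t 0, this bounds max (u - d) 0 by its chord on [0, h]. *)
Lemma abs_centered_chord (R : realFieldType) (h d u : R) :
  0 <= d -> d <= h -> u <= h ->
  h * (`|u - d| + (u - d)) <= (`|u| + u) * (h - d).
Proof.
move=> d0 dh uh.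
have e : 0 <= d * (h - u) by rewrite mulr_ge0 //; lra.
have [u0|u0] := leP 0 u; have [ud|ud] := leP 0 (u - d).
- by rewrite !ger0_norm//; lra.
- rewrite (ger0_norm u0) (ltr0_norm ud) addNr mulr0.
  by apply: mulr_ge0; lra.
- lra.
- by rewrite !ltr0_norm// !addNr mulr0 mul0r.
Qed.

(** * Integration over the unit interval *)

Section UnitInterval.
Variable R : realType.
Implicit Types (f g : R -> R) (m k : R).

Notation U := (`[0, 1]%classic : set R).
Notation mu := (@lebesgue_measure R).
Notation unit_integrable f := (mu.-integrable U (EFin \o f)).

Lemma measurable_unit : measurable (U : set (measurableTypeR R)).
Proof. exact: measurable_itv. Qed.

Lemma measure_unit : mu U = 1%E.
Proof. by rewrite lebesgue_measure_itv /= lte_fin ltr01 oppr0 adde0. Qed.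

Lemma measure_unit_fin : (mu U < +oo)%E.
Proof. by rewrite measure_unit ltry. Qed.

Lemma unit_integrable_cst k : unit_integrable (fun=> k).
Proof.
apply: measurable_bounded_integrable => //.
- exact: measure_unit_fin.
- by exists `|k|; split=> // M kM x _ /=; apply: ltW.
Qed.

Lemma unit_integrableD f g : unit_integrable f -> unit_integrable g ->
  unit_integrable (fun x => f x + g x).
Proof. move=> sf sg; exact: (integrableD measurable_unit sf sg). Qed.

Lemma unit_integrableB f g : unit_integrable f -> unit_integrable g ->
  unit_integrable (fun x => f x - g x).
Proof. move=> sf sg; exact: (integrableB measurable_unit sf sg). Qed.

Lemma unit_integrableZ k f : unit_integrable f -> unit_integrable (fun x => k * f x).
Proof. move=> sf; exact: (integrableZl measurable_unit k sf). Qed.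

Lemma unit_integrable_abs f : unit_integrable f -> unit_integrable (fun x => `|f x|).
Proof. move=> sf; exact: (integrable_norm sf). Qed.

Lemma mean_cst k : mean (fun=> k) = k.
Proof.
rewrite /mean Rintegral_cst// -[RHS]mulr1; congr (_ * _).
exact: (congr1 fine measure_unit).
Qed.

Lemma meanD f g : unit_integrable f -> unit_integrable g ->
  mean (fun x => f x + g x) = mean f + mean g.
Proof. by move=> sf sg; rewrite /mean RintegralD. Qed.

Lemma meanB f g : unit_integrable f -> unit_integrable g ->
  mean (fun x => f x - g x) = mean f - mean g.
Proof. by move=> sf sg; rewrite /mean RintegralB. Qed.

Lemma meanZ k f : unit_integrable f -> mean (fun x => k * f x) = k * mean f.
Proof. by move=> sf; rewrite /mean RintegralZl. Qed.

Lemma le_mean f g : unit_integrable f -> unit_integrable g ->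
  (forall x, x \in `[0, 1] -> f x <= g x) -> mean f <= mean g.
Proof. by move=> sf sg fg; rewrite /mean le_Rintegral. Qed.

Lemma eq_mean f g : (forall x, x \in `[0, 1] -> f x = g x) -> mean f = mean g.
Proof. by move=> fg; apply: eq_Rintegral => x; rewrite inE => /fg. Qed.

Lemma le_mean_abs f : unit_integrable f -> `|mean f| <= mean (fun x => `|f x|).
Proof. by move=> sf; rewrite /mean le_normr_Rintegral. Qed.

(** * Mean absolute deviation from a constant, and its minimum *)

Definition deviation f m : R := mean (fun x => `|f x - m|).

Lemma unit_integrable_deviation f m : unit_integrable f -> unit_integrable (fun x => `|f x - m|).
Proof.
by move=> sf; apply/unit_integrable_abs/unit_integrableB; [exact: sf|exact: unit_integrable_cst].
Qed.

Lemma deviation_lipschitz f m k : unit_integrable f ->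
  deviation f m <= deviation f k + `|m - k|.
Proof.
move=> sf; rewrite -[X in _ + X]mean_cst -meanD.
- apply: le_mean => [||x _]; first exact: unit_integrable_deviation.
    by apply: unit_integrableD; [exact: unit_integrable_deviation|exact: unit_integrable_cst].
  by rewrite (distrC m) (le_trans _ (ler_normD _ _))// addrA subrK.
- exact: unit_integrable_deviation.
- exact: unit_integrable_cst.
Qed.

Lemma deviation_continuous f : unit_integrable f -> continuous (deviation f).
Proof.
move=> sf m; apply/cvgrPdist_le => e e0; near=> k.
have mk : `|m - k| <= e by near: k; exact: cvgr_dist_le.
have := deviation_lipschitz _ m k sf; have := deviation_lipschitz _ k m sf.
rewrite (distrC k m) ler_norml => ? ?; lra.
Unshelve. all: by end_near. Qed.

(** The extreme value theorem gives a minimizer on the compact interval [- M, M]. It is global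
    because f takes its values there, so no constant outside can do better than the nearer
    endpoint. *)
Lemma deviation_min f M : 0 <= M -> unit_integrable f ->
  (forall x, x \in `[0, 1] -> `|f x| <= M) ->
  exists m, forall k, deviation f m <= deviation f k.
Proof.
move=> M0 sf fM.
have [|m _ mP] := @EVT_min _ (deviation f) (- M) M _
  (continuous_subspaceT (deviation_continuous _ sf)); first lra.
exists m => k.
(* Clamping k to [-M, M] does not increase the deviation. *)
pose k' := if k < - M then - M else if M < k then M else k.
have k'M : k' \in `[- M, M].
  by rewrite in_itv /k' /=; case: ltP => ?; [|case: ltP => ?]; lra.
apply: le_trans (mP _ k'M) _; apply: le_mean => [||x /fM].
- exact: unit_integrable_deviation.
- exact: unit_integrable_deviation.
rewrite ler_norml => /andP[x1 x2]; rewrite /k'.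
case: ltP => k1; [|case: ltP => k2 //].
- by rewrite !ger0_norm; lra.
- by rewrite !ler0_norm; lra.
Qed.

Lemma mean_ge f k : unit_integrable f ->
  (forall x, x \in `[0, 1] -> k <= f x) -> k <= mean f.
Proof. by move=> sf ?; rewrite -[leLHS]mean_cst le_mean//; exact: unit_integrable_cst. Qed.

Lemma mean_le f k : unit_integrable f ->
  (forall x, x \in `[0, 1] -> f x <= k) -> mean f <= k.
Proof. by move=> sf ?; rewrite -[leRHS]mean_cst le_mean//; exact: unit_integrable_cst. Qed.

Lemma deviation_mean_bound f m M : 0 < M -> unit_integrable f ->
  (forall x, x \in `[0, 1] -> `|f x| <= M) ->
  (forall k, deviation f m <= deviation f k) ->
  M * deviation f (mean f) <= deviation f m * (2 * M - deviation f m).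
Proof.
wlog mf : f m / m <= mean f => [wl M0 sf fM mP|M0 sf fM mP].
  have [mf|mf] := leP m (mean f); first exact: wl.
  pose g x := -1 * f x.
  have sg : unit_integrable g by exact: unit_integrableZ.
  have gE : mean g = - mean f by rewrite meanZ// mulN1r.
  have dE k : deviation g k = deviation f (- k).
    by apply: eq_mean => x _; rewrite /g -normrN; congr `| _ |; ring.
  have := wl g (- m); rewrite !dE gE !opprK; apply => //; first lra.
  - by move=> x /fM; rewrite /g mulN1r normrN.
  - by move=> k; rewrite dE.
have sm := unit_integrable_deviation _ m sf.
have sc k := unit_integrable_cst k.
set D := deviation f m in mP *; set L := deviation f (mean f).
pose d := mean f - m; pose h := M - m; pose l := M + m.
have fB x : x \in `[0, 1] -> - M <= f x <= M by move/fM; rewrite ler_norml.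
have d0 : 0 <= d by rewrite /d; lra.
have dD : d <= D.
  rewrite /d -[X in _ - X]mean_cst -meanB//.
  by apply: (le_trans (ler_norm _)); apply: le_mean_abs; exact: unit_integrableB.
(* As f <= M on the unit interval, [deviation f M] equals M - mean f = h - d, and it is at least the
   minimum D. The constant - M is handled symmetrically: its deviation is l + d. *)
have hh : D + d <= h.
  suff -> : h = deviation f M + d by rewrite lerD2r.
  rewrite /deviation (@eq_mean _ (fun x => M - f x)).
    by rewrite meanB// mean_cst /h /d; ring.
  by move=> x /fB ?; rewrite ler0_norm; lra.
have hl : D - d <= l.
  suff -> : l = deviation f (- M) - d by rewrite lerD2r.
  rewrite /deviation (@eq_mean _ (fun x => f x - (- M))).
    by rewrite meanB// mean_cst /l /d; ring.
  by move=> x /fB ?; rewrite ger0_norm; lra.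
(* Integrate [abs_centered_chord] at u = f x - m. On the left f x - mean f integrates to 0, leaving
   h L; on the right f x - m integrates to d. *)
have HL : h * L <= (D + d) * (h - d).
  have -> : h * L = mean (fun x => h * (`|f x - mean f| + (f x - mean f))).
    rewrite meanZ; last first.
      by apply: unit_integrableD; [exact: unit_integrable_deviation|exact: unit_integrableB].
    rewrite meanD; [|exact: unit_integrable_deviation|exact: unit_integrableB].
    by rewrite meanB// mean_cst subrr addr0.
  have -> : (D + d) * (h - d) =
      mean (fun x => (h - d) * (`|f x - m| + (f x - m))).
    rewrite meanZ; last by apply: unit_integrableD => //; exact: unit_integrableB.
    rewrite meanD//; last exact: unit_integrableB.
    by rewrite meanB// mean_cst mulrC.
  apply: le_mean => [||x /fB xB].
  - apply/unit_integrableZ/unit_integrableD; first exact: unit_integrable_deviation.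
    exact: unit_integrableB.
  - by apply/unit_integrableZ/unit_integrableD => //; exact: unit_integrableB.
  rewrite [leRHS]mulrC.
  have := @abs_centered_chord _ h d (f x - m) d0.
  have -> : f x - m - d = f x - mean f by rewrite /d; ring.
  by apply; [|rewrite /h]; lra.
have [h0|h0] := ltP 0 h.
  have := weighted_deviation_bound _ _ _ _ _ _ d0 dD hh hl h0 HL.
  have -> : h + l = 2 * M by rewrite /h /l; ring.
  nra.
(* If h <= 0, then 0 <= d <= D and D + d <= h force D = d = 0; so m is the mean and L = D = 0. *)
have D0 : D = 0 by lra.
have mE : mean f = m by rewrite /d in d0 dD; lra.
by rewrite /L mE -/D D0; lra.
Qed.

(** A shift alpha in the distance is the constant - alpha in the deviation of f - g. Since
    [deviation_min] makes the minimum attained, the default 0 in [minimum] is never taken for want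
    of a least element. *)
Lemma D1_updownP f g M : 0 <= M -> unit_integrable f -> unit_integrable g ->
  (forall x, x \in `[0, 1] -> `|f x - g x| <= M) ->
  exists2 m, D1_updown f g = deviation (fun x => f x - g x) m &
    forall k, D1_updown f g <= deviation (fun x => f x - g x) k.
Proof.
move=> M0 sf sg fgM.
set I := deviation _.
have E k : \int[mu]_(x in U) `|f x + k - g x| = I (- k).
  by apply: eq_mean => x _; congr `| _ |; ring.
have [m mP] := deviation_min _ _ M0 (unit_integrableB _ _ sf sg) fgM.
rewrite /D1_updown /minimum.
set S := (X in X `&` _); have : (S `&` lbound S) (xget 0 (S `&` lbound S)).
  apply: xgetPex; exists (I m); split.
    by exists (- m) => //; rewrite E opprK.
  by move=> _ [k _ <-]; rewrite E mP.
move=> [[k _ <-] lb]; exists (- k) => [|k']; first by rewrite E.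
by apply: lb; exists (- k') => //; rewrite E opprK.
Qed.

(** * Measurability and integrability of step functions *)

Lemma step_function_measurable f : step_function f -> measurable_fun U f.
Proof.
move=> [n [J [JU _ Jf]]] _ Y mY.
(* By constancy, one point sent into Y puts its whole piece in the preimage. Selecting pieces by
   such a witness discards the empty ones, whose constant is arbitrary. *)
have -> : U `&` f @^-1` Y =
    \bigcup_(i in [set i | exists2 x, x \in J i & Y (f x)]) [set` J i].
  rewrite -JU; apply/seteqP; split=> [x [[i _ /= xi] Yx]|x [i [y yi Yy] /= xi]].
    by exists i => //; exists x.
  split; first by exists i.
  by have [v fv] := Jf i; rewrite /= (fv _ xi) -(fv _ yi).
apply: fin_bigcup_measurable => [|i _]; first exact: finite_finset.
exact: measurable_itv.
Qed.

Lemma bounded_unit_integrable A B f : measurable_fun U f ->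
  (forall x, x \in `[0, 1] -> A <= f x <= B) -> unit_integrable f.
Proof.
move=> mf fAB; apply: measurable_bounded_integrable => //.
  exact: measure_unit_fin.
exists (`|A| + `|B|); split; first exact: num_real.
move=> M kM x /= /fAB /andP[? ?]; apply: le_trans (ltW kM).
have := ler_norm B; have := ler_norm (- A); rewrite normrN ler_norml => ? ?.
by have := normr_ge0 A; have := normr_ge0 B => ? ?; apply/andP; split; lra.
Qed.

(** * Collisions and the region between two graphs *)

Definition between f g : set (measurableTypeR R * measurableTypeR R) :=
  [set w | w.1 \in `[0, 1] /\ (f w.1 != g w.1) &&
    ((f w.1 <= w.2 <= g w.1) || (g w.1 <= w.2 <= f w.1))].

Lemma measurable_between f g : measurable_fun U f -> measurable_fun U g ->
  measurable (between f g).
Proof.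
move=> mf mg.
(* Measurability of f and g is known only over the unit interval, so the region is obtained inside
   this strip, as the set where a boolean function is true. *)
pose D : set (measurableTypeR R * measurableTypeR R) := U `*` setT.
have mD : measurable D by apply: measurableX; [exact: measurable_unit|exact: measurableT].
have m1 h : measurable_fun U h -> measurable_fun D (fun w => h w.1).
  move=> mh; apply: (measurable_comp measurable_unit) mh _.
    by move=> _ [w [? _] <-].
  by apply: measurable_funTS; exact: measurable_fst.
have m2 : measurable_fun D (fun w : measurableTypeR R * measurableTypeR R => w.2).
  by apply: measurable_funTS; exact: measurable_snd.
have mb : measurable_fun D (fun w => (f w.1 != g w.1) &&
    ((f w.1 <= w.2 <= g w.1) || (g w.1 <= w.2 <= f w.1))).
  apply: measurable_and.
    by apply: measurable_neg; apply: measurable_realfun.measurable_fun_eqr; apply: m1.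
  by apply: measurable_or; apply: measurable_and;
    apply: measurable_realfun.measurable_fun_ler => //; apply: m1.
have := mb mD [set true]; set P := _ `&` _.
have -> : P = between f g.
  by apply/seteqP; split => [w [[wU _] wP]|w [wU wP]].
by apply.
Qed.

(** The product measure integrates the measures of vertical sections. Over x in the unit interval
    the section is empty or a closed interval of length |f x - g x|; elsewhere it is empty. *)
Lemma area_between f g :
  area (between f g) = (\int[mu]_(x in U) (`|f x - g x|)%:E)%E.
Proof.
rewrite /area /product_measure1 [RHS]integral_mkcond.
apply: eq_integral => x _ /=; rewrite patchE.
have [xU|xU] := boolP (x \in `[0, 1]); last first.
  rewrite memNset; last exact/negP.
  rewrite (_ : xsection _ _ = set0) ?measure0//.
  by apply/seteqP; split => y //; rewrite /xsection /= inE => -[/= /(negP xU)].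
rewrite mem_set//.
have -> : xsection (between f g) x =
    if f x == g x then set0 else `[Num.min (f x) (g x), Num.max (f x) (g x)]%classic.
  apply/seteqP; split => y; rewrite /xsection /= inE /between /=.
    by case: (ltgtP (f x) (g x)) => fg [_]//=; rewrite in_itv /= => /orP[]/andP[? ?];
      apply/andP; split; lra.
  by case: (ltgtP (f x) (g x)) => fg //=; rewrite in_itv /= => ->; rewrite ?orbT.
case: (ltgtP (f x) (g x)) => fg.
- by rewrite lebesgue_measure_itv /= lte_fin fg ltr0_norm ?subr_lt0// opprB.
- by rewrite lebesgue_measure_itv /= lte_fin fg gtr0_norm ?subr_gt0.
- by rewrite measure0 fg subrr normr0.
Qed.

(** The endpoints count as non-collisions: at y = f x, with g x distinct, one hash is 0 and the
    other is not. Where f x = g x the hashes agree for every y. *)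
Lemma collision_between A B f g :
  collision (H1 A B) f g = index_set (H1 A B) `\` between f g.
Proof.
apply/seteqP; split=> [w [wS h]|w [wS h]]; split=> //.
  move=> [_ /andP[/eqP fg /orP[]/andP[]]]; move: h; rewrite /= /hash1;
  case: (ltgtP (f w.1) w.2) => ?; case: (ltgtP (g w.1) w.2) => ? //= _; lra.
have wU := wS.1; rewrite /= /hash1; apply: contrapT => ne; apply: h.
split=> //; move: ne.
by case: (ltgtP (f w.1) w.2) => ?; case: (ltgtP (g w.1) w.2) => ? //= _;
  apply/andP; split; try (apply/orP); try lra.
Qed.

(** The bounds on f and g keep the region between their graphs inside the rectangle of area B - A,
    so the whole area of that region is removed from it. *)
Lemma collision_probability A B f g : A < B ->
  measurable_fun U f -> measurable_fun U g ->
  (forall x, x \in `[0, 1] -> A <= f x <= B) ->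
  (forall x, x \in `[0, 1] -> A <= g x <= B) ->
  measurable (collision (H1 A B) f g) /\
  uniform_pr (@area R) (index_set (H1 A B)) (collision (H1 A B) f g) =
    1 - mean (fun x => `|f x - g x|) / (B - A).
Proof.
move=> AB mf mg fAB gAB; rewrite collision_between.
set S := index_set _.
have mS : measurable S by apply: measurableX; exact: measurable_itv.
have mN := measurable_between _ _ mf mg.
split; first exact: measurableD.
have muAB : mu `[A, B]%classic = (B - A)%:E.
  by rewrite lebesgue_measure_itv /= lte_fin AB.
have areaS : area S = (B - A)%:E.
  rewrite /area product_measure1E; [|exact: measurable_itv|exact: measurable_itv].
  rewrite -[RHS]mul1e; congr (_ * _)%E; first exact: measure_unit.
  exact: muAB.
have NS : S `&` between f g = between f g.
  apply/setIidPr => w [wU /andP[_ wfg]]; split => //=.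
  have := fAB _ wU; have := gAB _ wU; rewrite in_itv /=.
  by case/orP: wfg => /andP[? ?] /andP[? ?] /andP[? ?]; apply/andP; split; lra.
have sfg : unit_integrable (fun x => `|f x - g x|).
  by apply/unit_integrable_abs/unit_integrableB; exact: (bounded_unit_integrable A B).
have areaN : area (between f g) = (mean (fun x => `|f x - g x|))%:E.
  rewrite area_between /mean /Rintegral fineK//.
  exact: integrable_fin_num.
rewrite /uniform_pr areaS /area measureD//; last first.
  by rewrite [X in (X < _)%E]areaS ltry.
rewrite NS [X in (X - _)%E]areaS [X in (_ - X)%E]areaN /=.
by rewrite mulrBl divff// subr_eq0 gt_eqF.
Qed.

End UnitInterval.

(** * Both probability bounds for centered step functions *)

Theorem theorem3p4 (R : realType) (a b : R) (hab : a < b)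
    (r : R) (hr0 : 0 < r) (hrab : r < b - a)
    (c : R) (hc : 2 - r / (b - a) < c) :
  LSH_family (@area R) (H1_updown a b) (step_functions a b) (@D1_updown R) r c
    (1 - (2 - r / (b - a)) * (r / (2 * (b - a))))
    (1 - c * (r / (2 * (b - a)))).
Proof.
have M0 : 0 < b - a by rewrite subr_gt0.
have q0 : 0 < r / (2 * (b - a)) by rewrite divr_gt0// mulr_gt0.
split=> //.
(* From r < b - a, the lower bound on c exceeds 1. Next, p2 < p1 is this lower bound multiplied by r
   / (2 (b - a)). *)
- by apply: lt_trans hc; rewrite ltrBrDl -ltrBrDr ltr_pdivrMr//; lra.
- by rewrite ltrD2l ltrN2 ltr_pM2r.
move=> f g [stepf fab] [stepg gab].
have mf := step_function_measurable _ _ stepf.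
have mg := step_function_measurable _ _ stepg.
have sum_ab (h : R -> R) : measurable_fun (`[0, 1]%classic : set R) h ->
    (forall x, 0 <= x <= 1 -> a <= h x <= b) ->
    (@lebesgue_measure R).-integrable (`[0, 1]%classic : set R) (EFin \o h).
  move=> mh hab'; apply: (bounded_unit_integrable _ a b _ mh) => x.
  by rewrite in_itv /= => /hab'.
have sf := sum_ab _ mf fab; have sg := sum_ab _ mg gab.
(* The mean of h also lies in [a, b], so centering lands in [a - b, b - a], the range of y in the
   family. *)
have cent (h : R -> R) : measurable_fun (`[0, 1]%classic : set R) h ->
    (forall x, 0 <= x <= 1 -> a <= h x <= b) ->
    measurable_fun (`[0, 1]%classic : set R) (centered h) /\
    forall x, x \in `[0, 1] -> a - b <= centered h x <= b - a.
  move=> mh hab'; split; first exact: (measurable_realfun.measurable_funB mh (measurable_cst _)).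
  have sh := sum_ab _ mh hab'.
  have : a <= mean h by apply: mean_ge => // x; rewrite in_itv /= => /hab' /andP[].
  have : mean h <= b by apply: mean_le => // x; rewrite in_itv /= => /hab' /andP[].
  move=> ? ? x; rewrite in_itv /= /centered => /hab' /andP[? ?].
  by apply/andP; split; lra.
have [mcf cfab] := cent _ mf fab; have [mcg cgab] := cent _ mg gab.
have AB : a - b < b - a by lra.
have [mc prE] := collision_probability _ _ _ _ _ AB mcf mcg cfab cgab.
pose phi x := f x - g x.
have phiM x : x \in `[0, 1] -> `|f x - g x| <= b - a.
  rewrite in_itv /= => x01; have /andP[? ?] := fab _ x01.
  by have /andP[? ?] := gab _ x01; rewrite ler_norml; apply/andP; split; lra.
have [m DE Dmin] := D1_updownP _ _ _ _ (ltW M0) sf sg phiM.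
(* Centering commutes with subtraction. *)
have LE : mean (fun x => `|centered f x - centered g x|) =
    deviation _ phi (mean phi).
  apply: eq_mean => x _; rewrite /centered /phi meanB//.
  by congr `| _ |; ring.
have sphi : (@lebesgue_measure R).-integrable (`[0, 1]%classic : set R) (EFin \o phi).
  exact: unit_integrableB.
have key := deviation_mean_bound _ phi m _ M0 sphi phiM.
rewrite -DE in key; have {}key := key Dmin.
have DL := Dmin (mean phi).
have prE' : uniform_pr (@area R) (index_set (H1_updown a b))
    (collision (H1_updown a b) f g) =
    1 - deviation _ phi (mean phi) / (2 * (b - a)).
  by rewrite -LE; have -> : 2 * (b - a) = b - a - (a - b) by ring.
split; first exact: mc.
- move=> Dr; rewrite prE' lerD2l lerN2 mulrA ler_pM2r ?invr_gt0 ?mulr_gt0//.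
  rewrite -(ler_pM2l M0) (le_trans key)//.
  have -> : (b - a) * ((2 - r / (b - a)) * r) = r * (2 * (b - a) - r).
    by field; lra.
  (* The map t |-> t (2 (b - a) - t) increases up to b - a, and D <= r < b - a. *)
  nra.
- move=> cD; rewrite prE' lerD2l lerN2 mulrA ler_pM2r ?invr_gt0 ?mulr_gt0//.
  exact: le_trans cD DL.
Qed.
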